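(* Let $A$ be any finite non-abelian simple group and let $\mathbb{D}$ be any commutative ring with identity. Then $A$ cannot be embedded into the Riordan group $\mathcal{R}(\mathbb{D})$ with coefficients in $\mathbb{D}$; that is, there is no injective group homomorphism $A\to\mathcal{R}(\mathbb{D})$.
   Context: Let $\mathbb{D}$ be a commutative ring with identity (possibly with zero divisors), and let $\mathbb{D}^*$ be its group of units. The Riordan group $\mathcal{R}(\mathbb{D})$ consists of all pairs $(g(t),f(t))$ of formal power series in $\mathbb{D}[[t]]$ with $g(t)=\sum_{k\ge 0} g_kt^k$, $g_0\in\mathbb{D}^*$, and $f(t)=\sum_{k\ge 1} f_kt^k$, $f_1\in\mathbb{D}^*$. The group operation is $$(g_1(t),f_1(t))\,(g_2(t),f_2(t))=\bigl(g_1(t)\,g_2(f_1(t)),\ f_2(f_1(t))\bigr)$$ (here $f_1(t),f_2(t)$ denote power series), and the identity is $(1,t)$. The pair $(g,f)$ is identified with the infinite lower triangular matrix (Riordan array) $(d_{n,k})_{n,k\ge 0}$, $d_{n,k}=[t^n]\,g(t)f(t)^k$, where $[t^n]h(t)$ is the coefficient of $t^n$ in $h(t)$; under this identification the operation is matrix multiplication. *)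

(* Defs.v *)
From HB Require Import structures.
From mathcomp Require Import all_boot all_algebra.
From mathcomp Require Import boolp.
Set Implicit Arguments.
Unset Strict Implicit.
Unset Printing Implicit Defensive.
Import GRing.Theory.
Local Open Scope ring_scope.

(* GRing.unit needs a unitRingType, which has decidable units and 0 != 1;
   neither is assumed of the coefficient ring. *)
Definition invertible (D : pzRingType) (x : D) : Prop :=
  exists y, x * y = 1 /\ y * x = 1.

Record fps (D : Type) := FPS { fps_coef :> nat -> D }.

HB.instance Definition _ (D : Type) := gen_eqMixin (fps D).
HB.instance Definition _ (D : Type) := gen_choiceMixin (fps D).

Lemma fpsP (D : Type) (a b : fps D) : (forall n, a n = b n) <-> a = b.
Proof.
split=> [|-> //]; case: a b => [a] [b] /= eq_ab.
by congr FPS; apply/funext.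
Qed.

Section FPSRing.
Variable D : comPzRingType.
Implicit Types a b c : fps D.

Definition fps_zero : fps D := FPS (fun=> 0).
Definition fps_opp a : fps D := FPS (fun n => - a n).
Definition fps_add a b : fps D := FPS (fun n => a n + b n).
Definition fps_one : fps D := FPS (fun n => (n == 0%N)%:R).
Definition fps_mul a b : fps D :=
  FPS (fun n => \sum_(i < n.+1) a i * b (n - i)%N).

Fact fps_addA : associative fps_add.
Proof. by move=> a b c; apply/fpsP => n /=; rewrite addrA. Qed.

Fact fps_addC : commutative fps_add.
Proof. by move=> a b; apply/fpsP => n /=; rewrite addrC. Qed.

Fact fps_add0 : left_id fps_zero fps_add.
Proof. by move=> a; apply/fpsP => n /=; rewrite add0r. Qed.

Fact fps_addN : left_inverse fps_zero fps_opp fps_add.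
Proof. by move=> a; apply/fpsP => n /=; rewrite addNr. Qed.

HB.instance Definition _ :=
  GRing.isZmodule.Build (fps D) fps_addA fps_addC fps_add0 fps_addN.

Fact fps_mul_rev a b n :
  fps_mul a b n = \sum_(i < n.+1) a (n - i)%N * b i.
Proof.
rewrite /= (reindex_inj rev_ord_inj) /=.
by apply: eq_bigr => j _; rewrite subSS subKn // -ltnS.
Qed.

Fact fps_mulC : commutative fps_mul.
Proof.
move=> a b; apply/fpsP => n; rewrite fps_mul_rev /=.
by apply: eq_bigr => i _; rewrite mulrC.
Qed.

Fact fps_mulA : associative fps_mul.
Proof.
move=> p q r; apply/fpsP => i; rewrite [RHS]fps_mul_rev [LHS]/=.
pose coef3 j k := p j * (q (i - j - k)%N * r k).
transitivity (\sum_(j < i.+1) \sum_(k < i.+1 | (k <= i - j)%N) coef3 j k).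
  apply: eq_bigr => /= j _.
  rewrite -[\sum_(_ < _) _]/(fps_mul q r (i - j)%N) fps_mul_rev big_distrr /=.
  by rewrite (big_ord_narrow_leq (leq_subr _ _)).
rewrite (exchange_big_dep predT) //=; apply: eq_bigr => k _.
transitivity (\sum_(j < i.+1 | (j <= i - k)%N) coef3 j k).
  apply: eq_bigl => j; rewrite -ltnS -(ltnS j) -!subSn ?leq_ord //.
  by rewrite -subn_gt0 -(subn_gt0 j) -!subnDA addnC.
rewrite (big_ord_narrow_leq (leq_subr _ _)) big_distrl /=.
by apply: eq_bigr => j _; rewrite /coef3 -!subnDA addnC mulrA.
Qed.

Fact fps_mul1 : left_id fps_one fps_mul.
Proof.
move=> a; apply/fpsP => n /=.
by rewrite big_ord_recl mul1r subn0 big1 ?addr0 // => i _; rewrite mul0r.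
Qed.

Fact fps_mulDl : left_distributive fps_mul fps_add.
Proof.
move=> a b c; apply/fpsP => n /=; rewrite -big_split /=.
by apply: eq_bigr => i _; rewrite mulrDl.
Qed.

HB.instance Definition _ := GRing.Zmodule_isComPzRing.Build (fps D)
  fps_mulA fps_mulC fps_mul1 fps_mulDl.

Lemma fps_coef1 n : (1 : fps D) n = (n == 0%N)%:R.
Proof. by []. Qed.

Lemma fps_coefM a b n : (a * b) n = \sum_(i < n.+1) a i * b (n - i)%N.
Proof. by []. Qed.

Definition fpsX : fps D := FPS (fun n => (n == 1%N)%:R).

(* g(f(t)); only meaningful when f 0 = 0, in which case f ^+ k contributes to
   the coefficient of t^n for k <= n only. *)
Definition fps_comp (g f : fps D) : fps D :=
  FPS (fun n => \sum_(k < n.+1) g k * (f ^+ k) n).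

Implicit Types f g h : fps D.

Lemma fps_exp_small f k n : f 0%N = 0 -> (n < k)%N -> (f ^+ k) n = 0.
Proof.
move=> f0; elim: k n => // k IHk n lt_nk; rewrite exprS fps_coefM.
rewrite big_ord_recl f0 mul0r add0r big1 // => i _.
rewrite IHk ?mulr0 // lift0; apply: leq_trans (_ : n <= k)%N; last by [].
by rewrite ltn_subrL /= (leq_ltn_trans (leq0n i)).
Qed.

Lemma fps_exp_diag f n : f 0%N = 0 -> (f ^+ n) n = f 1%N ^+ n.
Proof.
move=> f0; elim: n => // n IHn; rewrite !exprS fps_coefM.
rewrite big_ord_recl f0 mul0r add0r big_ord_recl /= subSS subn0 IHn.
rewrite big1 ?addr0 // => i _; rewrite fps_exp_small ?mulr0 //.
by rewrite /bump !leq0n !add1n subSS ltn_subrL /= (leq_ltn_trans (leq0n i)).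
Qed.

Lemma fps_comp_widen g f n N : f 0%N = 0 -> (n <= N)%N ->
  fps_comp g f n = \sum_(k < N.+1) g k * (f ^+ k) n.
Proof.
move=> f0 le_nN; rewrite /= (big_ord_widen N.+1 (fun k => g k * (f ^+ k) n)) //.
rewrite big_mkcond; apply: eq_bigr => k _; case: ltnP => // lt_nk.
by rewrite fps_exp_small ?mulr0.
Qed.

Lemma fps_comp0 g f : fps_comp g f 0%N = g 0%N.
Proof. by rewrite /= big_ord1 expr0 mulr1. Qed.

Lemma fps_comp_coef1 g f : f 0%N = 0 -> fps_comp g f 1%N = g 1%N * f 1%N.
Proof.
by move=> f0; rewrite /= big_ord_recl big_ord1 expr0 mulr0 add0r expr1.
Qed.

Lemma fps_comp1 f : fps_comp 1 f = 1.
Proof.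
apply/fpsP => n; rewrite /= big_ord_recl big1 ?addr0 ?expr0 ?mul1r //.
by move=> i _; rewrite mul0r.
Qed.

Lemma fps_compX f : f 0%N = 0 -> fps_comp fpsX f = f.
Proof.
move=> f0; apply/fpsP => -[|n]; first by rewrite fps_comp0 f0.
rewrite /= big_ord_recl mul0r add0r big_ord_recl mul1r expr1.
by rewrite big1 ?addr0 // => i _; rewrite mul0r.
Qed.

Lemma fps_coefXn k n : (fpsX ^+ k) n = (n == k)%:R.
Proof.
elim: k n => [|k IHk] n; first by [].
rewrite exprS fps_coefM big_ord_recl mul0r add0r.
case: n => [|n]; first by rewrite big_ord0.
rewrite big_ord_recl /= mul1r subSS subn0 IHk eqSS.
by rewrite big1 ?addr0 // => i _; rewrite mul0r.
Qed.

Lemma fps_comp_X g : fps_comp g fpsX = g.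
Proof.
apply/fpsP => n; rewrite /= big_ord_recr /= fps_coefXn eqxx mulr1.
rewrite big1 ?add0r // => i _.
by rewrite fps_coefXn gtn_eqF ?mulr0.
Qed.

Lemma fps_compM g h f : f 0%N = 0 ->
  fps_comp (g * h) f = fps_comp g f * fps_comp h f.
Proof.
move=> f0; apply/fpsP => n; pose F i j := g i * h j * (f ^+ (i + j)) n.
transitivity (\sum_(i < n.+1) \sum_(j < n.+1) F i j); last first.
  transitivity (\sum_(m < n.+1) \sum_(i < n.+1) \sum_(j < n.+1)
                  g i * h j * ((f ^+ i) m * (f ^+ j) (n - m)%N)).
    rewrite [RHS]exchange_big /=; apply: eq_bigr => i _.
    rewrite [RHS]exchange_big /=; apply: eq_bigr => j _.
    by rewrite /F exprD fps_coefM big_distrr.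
  rewrite fps_coefM; apply: eq_bigr => m _.
  rewrite (fps_comp_widen g f0 (leq_ord m)).
  rewrite (fps_comp_widen h f0 (leq_subr m n)).
  rewrite big_distrl; apply: eq_bigr => i _.
  rewrite big_distrr; apply: eq_bigr => j _.
  by rewrite /= mulrACA.
transitivity (\sum_(k < n.+1) \sum_(i < n.+1 | (i <= k)%N) F i (k - i)%N).
  apply: eq_bigr => k _; rewrite fps_coefM big_distrl /=.
  rewrite (big_ord_narrow_leq (leq_ord k)) /=.
  by apply: eq_bigr => i _; rewrite /F subnKC // leq_ord.
rewrite (exchange_big_dep predT) //=; apply: eq_bigr => i _.
rewrite -(big_mkord (fun k => i <= k)%N (fun k => F i (k - i)%N)).
rewrite -(big_nat_widenl i 0 n.+1 predT) // -{1}[nat_of_ord i]add0n big_addn.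
rewrite big_mkord (big_ord_widen n.+1 (fun j => F i (j + i - i)%N)) ?leq_subr //.
rewrite big_mkcond; apply: eq_bigr => j _; rewrite addnK.
case: ltnP => // le_nij; rewrite /F fps_exp_small ?mulr0 //.
by rewrite -leq_subLR.
Qed.

Lemma fps_compXn g f k : f 0%N = 0 -> fps_comp (g ^+ k) f = fps_comp g f ^+ k.
Proof.
move=> f0; elim: k => [|k IHk]; first by rewrite !expr0 fps_comp1.
by rewrite !exprS fps_compM // IHk.
Qed.

Lemma fps_compA g f h : f 0%N = 0 -> h 0%N = 0 ->
  fps_comp (fps_comp g f) h = fps_comp g (fps_comp f h).
Proof.
move=> f0 h0; apply/fpsP => n.
transitivity (\sum_(m < n.+1) \sum_(k < n.+1) g k * ((f ^+ k) m * (h ^+ m) n)).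
  apply: eq_bigr => m _; rewrite (fps_comp_widen g f0 (leq_ord m)).
  by rewrite big_distrl; apply: eq_bigr => k _; rewrite /= mulrA.
rewrite exchange_big; apply: eq_bigr => k _ /=.
by rewrite -fps_compXn // -big_distrr.
Qed.

Lemma invertible_exp (x : D) n : invertible x -> invertible (x ^+ n).
Proof.
by case=> y [xy yx]; exists (y ^+ n); rewrite -!exprMn xy yx expr1n.
Qed.

Lemma invertibleM (x y : D) : invertible x -> invertible y -> invertible (x * y).
Proof.
case=> x' [xx' x'x] [y' [yy' y'y]]; exists (x' * y').
by split; rewrite mulrACA ?xx' ?yy' ?x'x ?y'y mulr1.
Qed.

Lemma invertible1 : invertible (1 : D).
Proof. by exists 1; rewrite mulr1. Qed.

Lemma triangular_solve (M : nat -> nat -> D) (e : nat -> D) :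
  (forall n, invertible (M n n)) ->
  exists x : nat -> D, forall n, \sum_(k < n.+1) x k * M n k = e n.
Proof.
move=> invM; pose v n := projT1 (cid (invM n)).
have vM n : v n * M n n = 1 by rewrite /v; case: cid => y [].
pose step n (s : seq D) := (e n - \sum_(k < n) s`_k * M n k) * v n.
pose fix s n := if n is m.+1 then rcons (s m) (step m (s m)) else [::].
have size_s n : size (s n) = n by elim: n => //= n IHn; rewrite size_rcons IHn.
have s_nth n k : (k < n)%N -> (s n)`_k = (s k.+1)`_k.
  elim: n => // n IHn; rewrite ltnS leq_eqVlt => /predU1P[-> // | lt_kn].
  by rewrite -IHn //= nth_rcons size_s lt_kn.
exists (fun k => (s k.+1)`_k) => n.
rewrite big_ord_recr /= nth_rcons size_s ltnn eqxx /step -mulrA vM mulr1.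
have -> : \sum_(k < n) (s k.+1)`_k * M n k = \sum_(k < n) (s n)`_k * M n k.
  by apply: eq_bigr => k _; rewrite (s_nth n).
by rewrite addrC subrK.
Qed.

Lemma fps_div_comp g f h : f 0%N = 0 -> invertible (g 0%N) -> invertible (f 1%N) ->
  exists x : fps D, g * fps_comp x f = h.
Proof.
move=> f0 g0 f1.
have diag n : invertible ((g * f ^+ n) n).
  rewrite fps_coefM big_ord_recl subn0 fps_exp_diag // big1 ?addr0.
    by apply: invertibleM => //; apply: invertible_exp.
  by case: n => [[]|n i] // _; rewrite fps_exp_small ?mulr0 // lift0 subSS ltnS leq_subr.
have [x xP] :=
  @triangular_solve (fun n k => (g * f ^+ k) n) h diag; exists (FPS x); apply/fpsP => n.
rewrite -xP fps_coefM.
transitivity (\sum_(i < n.+1) \sum_(k < n.+1) x k * (g i * (f ^+ k) (n - i)%N)).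
  apply: eq_bigr => i _.
  rewrite (fps_comp_widen _ f0 (leq_subr i n)) big_distrr.
  by apply: eq_bigr => k _; rewrite /= mulrCA.
by rewrite exchange_big; apply: eq_bigr => k _; rewrite fps_coefM big_distrr.
Qed.

End FPSRing.

Section RiordanGroup.
Variable D : comPzRingType.

Record riordan := Riordan {
  riordan_g : fps D;
  riordan_f : fps D;
  riordan_g0 : invertible (riordan_g 0%N);
  riordan_f0 : riordan_f 0%N = 0;
  riordan_f1 : invertible (riordan_f 1%N)
}.

HB.instance Definition _ := gen_eqMixin riordan.
HB.instance Definition _ := gen_choiceMixin riordan.

Lemma riordanP (x y : riordan) :
  riordan_g x = riordan_g y -> riordan_f x = riordan_f y -> x = y.
Proof.
case: x y => [g f g0 f0 f1] [g' f' g0' f0' f1'] /= eq_g eq_f.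
subst g' f'; congr Riordan; exact: Prop_irrelevance.
Qed.

Fact riordan_mul_g0 x y :
  invertible ((riordan_g x * fps_comp (riordan_g y) (riordan_f x)) 0%N).
Proof.
rewrite fps_coefM big_ord1 fps_comp0.
by apply: invertibleM; apply: riordan_g0.
Qed.

Fact riordan_mul_f0 x y : fps_comp (riordan_f y) (riordan_f x) 0%N = 0.
Proof. by rewrite fps_comp0 riordan_f0. Qed.

Fact riordan_mul_f1 x y :
  invertible (fps_comp (riordan_f y) (riordan_f x) 1%N).
Proof.
rewrite fps_comp_coef1 ?riordan_f0 //.
by apply: invertibleM; apply: riordan_f1.
Qed.

Definition riordan_mul x y : riordan :=
  Riordan (riordan_mul_g0 x y) (riordan_mul_f0 x y) (riordan_mul_f1 x y).

Definition riordan_one : riordan :=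
  @Riordan 1 (fpsX D) (@invertible1 D) erefl (@invertible1 D).

Fact riordan_mulA : associative riordan_mul.
Proof.
move=> x y z; have [x0 y0] := (riordan_f0 x, riordan_f0 y).
by apply: riordanP; rewrite /= ?fps_compM // !fps_compA ?mulrA.
Qed.

Fact riordan_mul1 : left_id riordan_one riordan_mul.
Proof. by move=> x; apply: riordanP; rewrite /= fps_comp_X ?mul1r. Qed.

Fact riordan_mulr1 : right_id riordan_one riordan_mul.
Proof.
by move=> x; apply: riordanP; rewrite /= ?fps_comp1 ?mulr1 ?fps_compX ?riordan_f0.
Qed.

Lemma riordan_rinv x : exists y, riordan_mul x y = riordan_one.
Proof.
have [x0 x1] := (riordan_f0 x, riordan_f1 x).
have [g gP] := fps_div_comp 1 x0 (riordan_g0 x) x1.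
have [f] := @fps_div_comp D 1 _ (fpsX D) x0 (@invertible1 D) x1.
rewrite mul1r => fP.
have g0 : invertible (g 0%N).
  have /fpsP/(_ 0%N) := gP; rewrite fps_coefM big_ord1 fps_comp0 => eq1.
  by exists (riordan_g x 0%N); rewrite mulrC.
have f0 : f 0%N = 0 by have /fpsP/(_ 0%N) := fP; rewrite fps_comp0.
have f1 : invertible (f 1%N).
  have /fpsP/(_ 1%N) := fP; rewrite fps_comp_coef1 // => eq1.
  by exists (riordan_f x 1%N); split=> //; rewrite mulrC.
by exists (Riordan g0 f0 f1); apply: riordanP.
Qed.

(* The group laws pin the inverse down; no closed formula is needed. *)
Definition riordan_inv x : riordan := projT1 (cid (riordan_rinv x)).

Fact riordan_mulV : right_inverse riordan_one riordan_inv riordan_mul.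
Proof. by move=> x; rewrite /riordan_inv; case: cid. Qed.

Fact riordan_Vmul : left_inverse riordan_one riordan_inv riordan_mul.
Proof.
move=> x; rewrite -[LHS]riordan_mulr1 -(riordan_mulV (riordan_inv x)).
rewrite riordan_mulA -[in LHS](riordan_mulA _ x) riordan_mulV riordan_mulr1.
by rewrite riordan_mulV.
Qed.

HB.instance Definition _ := isGroup.Build riordan
  riordan_mulA riordan_mul1 riordan_mulr1 riordan_Vmul riordan_mulV.

End RiordanGroup.

(* Main.v *)
Require Import Defs.
From mathcomp Require Import all_boot all_algebra all_fingroup all_solvable.
Import GRing.Theory.

(** The Riordan group is residually solvable, whereas a non-abelian simple group
    is perfect. Indeed, reading off the constant coefficient of g and the linear
    coefficient of f gives two homomorphisms to the multiplicative monoid of the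
    coefficient ring. On the pairs with g = 1 mod t^(m+1) and f = t mod t^(m+2),
    reading off the coefficient of t^(m+1) in g and that of t^(m+2) in f gives
    homomorphisms to its additive group ([riordan_g_next], [riordan_f_next]).
    A perfect group has only the trivial homomorphism to a commutative monoid
    ([perfect_com_law_trivial]), so by induction on m all the coefficients of the
    image of every element are those of (1, t). A homomorphism from a perfect
    group to the Riordan group is therefore trivial ([riordan_perfect_trivial]),
    and cannot be injective. *)

Section Perfect.
Local Open Scope group_scope.

Lemma simple_nonabelian_perfect (gT : finGroupType) (G : {group gT}) :
  simple G -> ~~ abelian G -> G^`(1) = G.
Proof.
case/simpleP=> _ simG nabG.
have [derG1 | //] := simG [group of G^`(1)] (der_normal 1 G).
by case/negP: nabG; apply/derG1P.
Qed.

Lemma perfect_com_law_trivial (gT : finGroupType) (T : eqType) (idx : T)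
    (op : Monoid.com_law idx) (psi : gT -> T) :
  [set: gT]^`(1) = [set: gT] -> psi 1 = idx ->
  {morph psi : x y / x * y >-> op x y} -> forall x, psi x = idx.
Proof.
move=> perfG psi1 psiM x; pose K := [set y | psi y == idx].
have gK : group_set K.
  apply/group_setP; split=> [|y z]; rewrite !inE ?psi1 //.
  by move=> /eqP y1 /eqP z1; rewrite psiM y1 z1 Monoid.mul1m.
suff /subsetP/(_ x) : [set: gT] \subset Group gK by rewrite !inE => /(_ isT)/eqP.
rewrite -perfG dergSn derg0 gen_subG; apply/subsetP=> _ /imset2P[y z _ _ ->].
(* Exchanging z^-1 and y in y^-1 * (z^-1 * (y * z)) is allowed after applying
   psi, and brings each element next to its inverse. *)
rewrite inE commgEl conjgE !psiM [op (psi z^-1) _]Monoid.mulmCA Monoid.mulmA.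
rewrite -[X in X == _]/(op (op (psi y^-1) (psi y)) (op (psi z^-1) (psi z))).
by rewrite -!psiM !mulVg mul1g psi1.
Qed.

End Perfect.

Section Riordan.
Local Open Scope ring_scope.
Variable D : comPzRingType.
Implicit Types (h f : fps D) (x y : riordan D).

(** In the coefficient of t^(m+2) of h(f), the powers f^i with 1 < i <= m.+1 are
    killed by h, and f^(m+2) contributes its leading coefficient 1. *)
Lemma fps_comp_next h f m : f 0%N = 0 -> f 1%N = 1 ->
    (forall i, (1 < i <= m.+1)%N -> h i = 0) ->
  fps_comp h f m.+2 = h 1%N * f m.+2 + h m.+2.
Proof.
move=> f0 f1 hm.
rewrite -[LHS]/(\sum_(k < m.+3) h k * (f ^+ k) m.+2) 2!big_ord_recl big_ord_recr.
rewrite expr0 mulr0 add0r expr1; congr (_ + _); rewrite big1 => [|i _].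
  by rewrite Monoid.mul1m !lift0 fps_exp_diag // f1 expr1n mulr1.
by rewrite hm ?mul0r // !lift0 /= !ltnS.
Qed.

(** The pairs (g, f) with g = 1 mod t^(m+1) and f = t mod t^(m+2); the coefficient
    f 0 is zero in any case. *)
Definition riordan_congr1 m x := forall i, (i <= m)%N ->
  riordan_g x i = (1 : fps D) i /\ riordan_f x i.+1 = fpsX D i.+1.

Lemma riordan_g_next m x y : riordan_congr1 m x -> riordan_congr1 m y ->
  riordan_g (x * y)%g m.+1 = riordan_g x m.+1 + riordan_g y m.+1.
Proof.
move=> xm ym; have [[x0 x1] [y0 _]] := (xm 0%N isT, ym 0%N isT).
have compm : fps_comp (riordan_g y) (riordan_f x) m.+1 = riordan_g y m.+1.
  case: m xm ym => [|m] xm ym; first by rewrite fps_comp_coef1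
    ?riordan_f0 // x1 mulr1.
  rewrite fps_comp_next ?riordan_f0 // => [|i /andP[i1 im]].
    by have [-> _] := ym 1%N isT; rewrite mul0r add0r.
  by have [-> _] := ym i im; case: i i1 {im}.
rewrite [riordan_g (x * y)%g]/(riordan_g x * fps_comp (riordan_g y) (riordan_f x)).
rewrite fps_coefM big_ord_recl big_ord_recr subn0 compm subnn fps_comp0 x0 y0.
rewrite mul1r mulr1 big1 => [|i _]; first by rewrite Monoid.mul1m lift0 addrC.
by have [-> _] := xm _ (ltn_ord i); rewrite mul0r.
Qed.

Lemma riordan_f_next m x y : riordan_congr1 m x -> riordan_congr1 m y ->
  riordan_f (x * y)%g m.+2 = riordan_f x m.+2 + riordan_f y m.+2.
Proof.
move=> xm ym; have [[_ x1] [_ y1]] := (xm 0%N isT, ym 0%N isT).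
rewrite [riordan_f (x * y)%g]/(fps_comp (riordan_f y) (riordan_f x)).
rewrite fps_comp_next ?riordan_f0 ?y1 ?mul1r // => -[|i] // /andP[i1 im].
by have [_ ->] := ym i im; case: i i1 {im}.
Qed.

Lemma riordan_perfect_trivial (gT : finGroupType)
    (phi : {multiplicative gT -> riordan D}) :
  [set: gT]^`(1)%g = [set: gT] -> forall a, phi a = 1%g.
Proof.
move=> perfG.
have phi1 : phi 1%g = 1%g by apply: (mulgI (phi 1%g)); rewrite -gmulfM !mulg1.
have congrP m a : riordan_congr1 m (phi a).
  elim: m a => [|m IHm] a i.
    (* the coefficients g 0 and f 1 are multiplicative *)
    rewrite leqn0 => /eqP ->; split.
      apply: (perfect_com_law_trivial _ _ _ *%R (fun b => riordan_g (phi b) 0%N)) => //.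
        by rewrite phi1.
      move=> b c; rewrite gmulfM -(fps_comp0 (riordan_g (phi c)) (riordan_f (phi b))).
      by rewrite [LHS]fps_coefM big_ord1.
    apply: (perfect_com_law_trivial _ _ _ *%R (fun b => riordan_f (phi b) 1%N)) => //.
      by rewrite phi1.
    by move=> b c; rewrite gmulfM [LHS]fps_comp_coef1 ?riordan_f0 // [LHS]mulrC.
  rewrite leq_eqVlt => /predU1P[-> | /IHm//]; split.
    (* by induction, the next coefficients are additive *)
    apply: (perfect_com_law_trivial _ _ _ +%R (fun b => riordan_g (phi b) m.+1)) => //.
      by rewrite phi1.
    by move=> b c; rewrite gmulfM riordan_g_next.
  apply: (perfect_com_law_trivial _ _ _ +%R (fun b => riordan_f (phi b) m.+2)) => //.
    by rewrite phi1.
  by move=> b c; rewrite gmulfM riordan_f_next.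
move=> a; apply: riordanP; apply/fpsP=> i.
  by have [-> _] := congrP i a i (leqnn i).
case: i => [|i]; first by rewrite !riordan_f0.
by have [_ ->] := congrP i a i (leqnn i).
Qed.

End Riordan.

Theorem theorem6 (D : comPzRingType) (gT : finGroupType)
    (simpleA : simple [set: gT]) (nonabelianA : ~~ abelian [set: gT]) :
  ~ exists phi : {multiplicative gT -> riordan D}, injective phi.
Proof.
case=> phi phi_inj; have perfG := simple_nonabelian_perfect _ _ simpleA nonabelianA.
case/negP: nonabelianA; apply/centsP=> a _ b _.
by apply: phi_inj; rewrite !(riordan_perfect_trivial _ _ phi perfG).
Qed.
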